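(* Let $A=(a_{ij})_{n\times n}$ be a real matrix with nonnegative entries and $L=\mathrm{diag}(A\mathbf 1)-A$. Let $\boldsymbol{v}=(v_1,\ldots,v_n)^{\mathrm T}$ satisfy $v_i\ge 0$ $(i=1,\ldots,n)$ and $\sum_{i=1}^n v_i=1$, let $\delta>0$, and put $D=I-V$, $V=\mathbf 1\boldsymbol{v}^{\mathrm T}$. If $\boldsymbol{x}(t)$ is a solution to the system of equations $\dot{\boldsymbol{x}}(t)=-(L+\delta D)\,\boldsymbol{x}(t)$, $t\ge0$, then 1. $\displaystyle\lim_{t\to\infty}\boldsymbol{x}(t)=\mathbf 1\,\boldsymbol{v}^{\mathrm T}\big(I+\tfrac1\delta L\big)^{-1}\boldsymbol{x}(0)$; 2. $\displaystyle\lim_{\delta\to+0}\lim_{t\to\infty}\boldsymbol{x}(t)=\mathbf 1\,\boldsymbol{v}^{\mathrm T}\bar J\,\boldsymbol{x}(0)$, where the initial state $\boldsymbol{x}(0)$ is fixed independently of $\delta$ and $\bar J$ is the normalized matrix of maximum in-forests of the weighted dependency digraph $\Gamma$ of $A$.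
   Context: $\mathbf 1$ is the all-ones column vector of length $n$, $I$ is the identity matrix of order $n$, and $\mathrm{diag}(\boldsymbol{u})$ is the diagonal matrix with the entries of $\boldsymbol{u}$ on the diagonal. The weighted dependency digraph $\Gamma$ of $A$ has vertex set $\{1,\ldots,n\}$ and, for every $a_{ij}>0$, an arc $(i,j)$ (from $i$ to $j$) of weight $a_{ij}$. An in-tree (converging tree) with root $r$ is a digraph in which every vertex has a unique directed path to $r$, every vertex other than $r$ has outdegree $1$, and $r$ has outdegree $0$. An in-forest of $\Gamma$ is a spanning subgraph of $\Gamma$ all of whose weakly connected components are in-trees; it is maximum if it has the maximum possible number of arcs among all in-forests of $\Gamma$. The weight of an in-forest is the product of its arc weights (equal to $1$ if there are no arcs). The normalized matrix of maximum in-forests $\bar J=(\bar J_{ij})_{n\times n}$ has as entry $\bar J_{ij}$ the total weight of the maximum in-forests of $\Gamma$ in which $i$ belongs to the tree with root $j$, divided by the total weight of all maximum in-forests of $\Gamma$. (It is known that $\bar J$ coincides with the eigenprojection of $L$ corresponding to the eigenvalue $0$.) *)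

(* Defs.v *)
From HB Require Import structures.
From mathcomp Require Import all_boot all_order all_algebra.
From mathcomp Require Import all_classical all_reals all_analysis.

Set Implicit Arguments.
Unset Strict Implicit.
Unset Printing Implicit Defensive.

Import Order.TTheory GRing.Theory Num.Theory.
Import numFieldNormedType.Exports.

Local Open Scope classical_set_scope.
Local Open Scope ring_scope.

(* A digraph on (a subset of) a finite type T is given by its set of arcs;    *)
(* the pair (i, j) is the arc from i to j.  All subgraphs are spanning: only  *)
(* the set of arcs varies, the vertex set is the whole of T.                  *)
Section Digraphs.
Variable T : finType.
Implicit Types (E F : {set T * T}) (C : {set T}) (i r : T).

Definition arc E : rel T := fun i j => (i, j) \in E.

Definition outdegree E i : nat := #|[set j | arc E i j]%SET|.

(* The path visits i, then the vertices listed in p, without repetition.      *)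
Definition dipath E i r (p : seq T) : Prop :=
  [/\ path (arc E) i p, last i p = r & uniq (i :: p)].

Definition weak_component E i : {set T} :=
  [set j | connect (fun k l => arc E k l || arc E l k) i j]%SET.

Definition restrict E C : {set T * T} := E :&: finset.setX C C.

Definition in_tree C E r : Prop :=
  [/\ r \in C,
      forall i, i \in C -> exists! p, dipath E i r p,
      forall i, i \in C -> i != r -> outdegree E i = 1%N
    & outdegree E r = 0%N].

(* The weak component of i in F is a converging tree with root r.             *)
Definition in_tree_with_root F i r : Prop :=
  in_tree (weak_component F i) (restrict F (weak_component F i)) r.

Definition in_forest (G F : {set T * T}) : Prop :=
  F \subset G /\ forall i, exists r, in_tree_with_root F i r.

Definition maximum_in_forest (G F : {set T * T}) : Prop :=
  in_forest G F /\ forall F', in_forest G F' -> (#|F'| <= #|F|)%N.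

End Digraphs.

Section Weighted.
Variables (R : realType) (n : nat).
Implicit Type A : 'M[R]_n.

Definition ones : 'cV[R]_n := const_mx 1.

(* diag_mx expects a row vector, hence the transpose.                         *)
Definition laplacian A : 'M[R]_n := diag_mx (A *m ones)^T - A.

Definition dependency_digraph A : {set 'I_n * 'I_n} :=
  [set e | 0 < A e.1 e.2]%SET.

Definition forest_weight A (F : {set 'I_n * 'I_n}) : R :=
  \prod_(e in F) A e.1 e.2.

Definition Jbar A : 'M[R]_n :=
  \matrix_(i, j)
    ((\sum_(F : {set 'I_n * 'I_n} |
             `[< maximum_in_forest (dependency_digraph A) F /\
                 in_tree_with_root F i j >]) forest_weight A F) /
     (\sum_(F : {set 'I_n * 'I_n} |
             `[< maximum_in_forest (dependency_digraph A) F >])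
        forest_weight A F)).

(* x' = M x on [0, +oo[, the derivative at 0 being the right derivative; the  *)
(* values of x at negative times are irrelevant.                              *)
Definition ode_solution (M : 'M[R]_n) (x : R -> 'cV[R]_n) : Prop :=
  (forall t : R, 0 < t -> is_derive t 1 x (M *m x t)) /\
  (h^-1 *: (x h - x 0) @[h --> 0^'+] --> M *m x 0).

End Weighted.

Arguments ones {R n}.

(* Main.v *)
Require Import Defs.
From HB Require Import structures.
From mathcomp Require Import all_boot all_order all_algebra.
From mathcomp Require Import all_classical all_reals all_analysis.
From mathcomp Require Import ring.

Set Implicit Arguments.
Unset Strict Implicit.
Unset Printing Implicit Defensive.

Import Order.TTheory GRing.Theory Num.Theory.
Import numFieldNormedType.Exports.
Import Defs.

Local Open Scope classical_set_scope.
Local Open Scope ring_scope.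

(** Write M = L + d (I - 1 v^T), X = (I + L / d)^-1 and 1 for the column of
    ones.

    The limit in time. Since L 1 = 0 one has X 1 = 1, and the row w = v^T X
    satisfies w M = 0 and w 1 = 1: the quantity w x(t) is conserved
    (resolvent_weights_conserved). Put p = v^T Jbar. Since Jbar L = 0 and Jbar
    1 = 1, the vector u = x - 1 (p x) solves u' = - (L + d I) u
    (intertwine_decay), from which the rank-one term has disappeared. The
    largest coordinates of exp (d t) u(t) and of its opposite do not increase
    (maximum_principle), so u tends to 0. Now p x = w x - w u, and therefore x
    = u + 1 (w x(0) - w u) tends to 1 w x(0).

    The limit in d. It remains to see that X tends to Jbar as d tends to 0.
    This is a consequence of the matrix forest theorem: for a nonnegative
    matrix B with Laplacian L_B,

      (I + L_B) Q = s I,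

    where s is the total weight of the in-forests of B and Q_ij that of the
    in-forests in which i has root j. With B = A / d, a forest with k arcs has
    its weight multiplied by d^-k, so that in the quotients Q_ij / s only the
    forests with the maximum number of arcs matter in the limit
    (cvg_resolvent). The relations Jbar L = 0 and Jbar 1 = 1 used above are
    inherited from X.

    The matrix forest theorem is proved without determinants. A forest is
    encoded by its parent map f, with f r = r at the roots; every forest is
    obtained in a unique way from a forest in which a given vertex i is a
    root, by leaving it unchanged or by attaching i to a vertex of another
    tree (big_forest). Row i of the identity already holds for the
    contributions of each forest with root i separately (reroot_balance). *)

(** * In-forests as parent maps *)

Section ParentMaps.
Variable T : finType.
Implicit Types (f g : {ffun T -> T}) (i k r x : T).

(** A spanning in-forest is encoded by its parent map, whose fixed points
    are the roots. An orbit that reaches a fixed point does so within #|T|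
    steps, so that this iterate is the root of x whenever x has one. *)
Definition root_of f x : T := iter #|T| f x.

Definition is_forest f : bool := [forall x, f (root_of f x) == root_of f x].

Definition set_parent f i k : {ffun T -> T} :=
  [ffun x => if x == i then k else f x].

Lemma set_parentE f i k x : set_parent f i k x = if x == i then k else f x.
Proof. by rewrite ffunE. Qed.

Lemma set_parentK f i k : set_parent (set_parent f i k) i (f i) = f.
Proof. by apply/ffunP => x; rewrite !ffunE; case: eqP => // ->. Qed.

Lemma set_parent_id f i : set_parent f i (f i) = f.
Proof. by apply/ffunP => x; rewrite !ffunE; case: eqP => // ->. Qed.

Lemma set_parent2 f i k l :
  set_parent (set_parent f i k) i l = set_parent f i l.
Proof. by apply/ffunP => x; rewrite !ffunE; case: eqP. Qed.

Lemma iter_fixed f r m : f r = r -> iter m f r = r.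
Proof. by move=> fr; elim: m => //= m ->. Qed.

Lemma root_of_eq f x r : fconnect f x r -> f r = r -> root_of f x = r.
Proof.
move=> xr fr; rewrite /root_of.
have le_idx : (findex f x r <= #|T|)%N.
  by apply: leq_trans (ltnW (findex_max xr)) _; apply: max_card.
by rewrite -(subnK le_idx) iterD iter_findex // iter_fixed.
Qed.

Lemma is_forestP f :
  reflect (forall x, exists2 r, fconnect f x r & f r = r) (is_forest f).
Proof.
apply: (iffP forallP) => [ff x | ff x].
  by exists (root_of f x); [exact: fconnect_iter | exact/eqP].
by have [r xr fr] := ff x; rewrite (root_of_eq xr fr) fr.
Qed.

Lemma root_ofK f x : is_forest f -> f (root_of f x) = root_of f x.
Proof. by move=> /forallP/(_ x)/eqP. Qed.

Lemma root_of_fixed f r : f r = r -> root_of f r = r.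
Proof. exact: iter_fixed. Qed.

Lemma root_of_step f x : is_forest f -> root_of f (f x) = root_of f x.
Proof. by move=> ff; rewrite /root_of -iterSr /= root_ofK. Qed.

Lemma connect_set_parent f i k x :
  fconnect f x i -> fconnect (set_parent f i k) x i.
Proof.
move=> /iter_findex; move: (findex _ _ _) => m; elim: m x => [|m IHm] x.
  by move=> /= ->; apply: connect0.
rewrite iterSr => fxi; have [->|xi] := eqVneq x i; first exact: connect0.
apply: connect_trans (IHm _ fxi).
by apply: connect1; rewrite /= set_parentE (negPf xi).
Qed.

(** As i is a root, an f-path that visits i ends there; a path whose last
    vertex is not i has thus avoided i and does not see the change. *)
Lemma iter_set_parent f i k x m : f i = i -> iter m f x != i ->
  iter m (set_parent f i k) x = iter m f x.
Proof.
move=> fi; elim: m => //= m IHm neq_i.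
have neq : iter m f x != i by apply: contraNneq neq_i => ->; rewrite fi.
by rewrite IHm // set_parentE (negPf neq).
Qed.

(** Hanging the tree rooted at i below k: if k lies in another tree then the
    vertices of the tree of i inherit the root of k. The case k = i, where
    nothing changes, obeys the same formula. *)
Lemma root_set_parent f i k x : is_forest f -> f i = i ->
  (k == i) || (root_of f k != i) ->
  let r := if root_of f x == i then root_of f k else root_of f x in
  fconnect (set_parent f i k) x r /\ set_parent f i k r = r.
Proof.
move=> ff fi ik /=.
have far y : root_of f y != i -> fconnect (set_parent f i k) y (root_of f y) /\
    set_parent f i k (root_of f y) = root_of f y.
  move=> yi; rewrite set_parentE (negPf yi) root_ofK //; split=> //.
  by rewrite /root_of -(iter_set_parent k fi) //; apply: fconnect_iter.
have [xi|] := eqVneq (root_of f x) i; last exact: far.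
have fi' : set_parent f i k i = k by rewrite set_parentE eqxx.
have xi' : fconnect (set_parent f i k) x i.
  by apply: connect_set_parent; rewrite -xi; apply: fconnect_iter.
have ik' : fconnect (set_parent f i k) i k.
  by apply: connect1; rewrite /= fi'.
case/orP: ik => [/eqP ki|rk].
  by move: xi' fi'; rewrite ki root_of_fixed.
have [kr fkr] := far k rk; split=> //.
exact: connect_trans (connect_trans xi' ik') kr.
Qed.

Lemma forest_attach f i k : is_forest f -> f i = i ->
  (k == i) || (root_of f k != i) -> is_forest (set_parent f i k).
Proof.
move=> ff fi ik; apply/is_forestP => x.
have [xr fr] := root_set_parent x ff fi ik.
by eexists; [exact: xr | exact: fr].
Qed.

Lemma root_of_attach f i k x : is_forest f -> f i = i ->
  (k == i) || (root_of f k != i) ->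
  root_of (set_parent f i k) x =
  if root_of f x == i then root_of f k else root_of f x.
Proof.
move=> ff fi ik; have [xr fr] := root_set_parent x ff fi ik.
exact: root_of_eq.
Qed.

Lemma forest_detach f i : is_forest f -> is_forest (set_parent f i i).
Proof.
move=> ff; apply/is_forestP => x; set g := set_parent f i i.
have [r /iter_findex + fr] := is_forestP _ ff x; move: (findex _ _ _) => m.
elim: m x => [|m IHm] x.
  move=> /= ->; exists r; first exact: connect0.
  by rewrite set_parentE; case: eqP.
rewrite iterSr => /IHm [s xs gs].
have [->|xi] := eqVneq x i.
  by exists i; [exact: connect0 | rewrite set_parentE eqxx].
exists s => //; apply: connect_trans xs; apply: connect1.
by rewrite /= set_parentE (negPf xi).
Qed.

(** Cutting the arc from i to its parent p leaves p outside the tree of i: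
    otherwise i, p, ..., i would be a cycle of f, and i, lying on a cycle
    and leading to a fixed point, would itself be that fixed point. *)
Lemma root_of_detach f i : is_forest f ->
  (f i == i) || (root_of (set_parent f i i) (f i) != i).
Proof.
move=> ff; have [//|fi /=] := eqVneq (f i) i.
apply: contra fi => /eqP ri; apply/eqP.
have back : fconnect f (f i) i.
  have := fconnect_iter (set_parent f i i) #|T| (f i).
  rewrite -/(root_of _ _) ri => /(connect_set_parent (f i)).
  by rewrite set_parentK.
have loop : iter (findex f (f i) i).+1 f i = i by rewrite iterSr iter_findex.
(* Turning #|T| times round the cycle takes at least #|T| steps, hence leads
   to the root of i. *)
suff <- : root_of f i = i by rewrite root_ofK.
have {2}<- : iter (#|T| * (findex f (f i) i).+1) f i = i.
  elim: #|T| => [|m IHm]; first by rewrite mul0n.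
  by rewrite mulSn iterD IHm.
by rewrite mulnS addnC iterD -/(root_of f i) iter_fixed // root_ofK.
Qed.

(** Every forest arises exactly once from a forest in which i is a root,
    either unchanged (k = i) or by attaching i to a vertex k of another
    tree. All the forest identities below are proved by comparing, for each
    forest with root i, the contributions of the forests that arise from it. *)
Lemma big_forest (R : nmodType) i (Phi : {ffun T -> T} -> R) :
  \sum_(f | is_forest f) Phi f =
  \sum_(g | is_forest g && (g i == i))
     \sum_(k | (k == i) || (root_of g k != i)) Phi (set_parent g i k).
Proof.
rewrite pair_big_dep /=.
rewrite (reindex_onto (fun p => set_parent p.1 i p.2)
  (fun f => (set_parent f i i, f i))) /=; last first.
  by move=> f _; rewrite set_parentK.
apply: eq_big => [[g k] | p _ //] /=.
rewrite set_parentE eqxx xpair_eqE eqxx andbT.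
rewrite set_parent2; apply/andP/andP => [[ff /eqP gi]|[/andP[fg /eqP gi] ik]].
  have := forest_detach i ff; rewrite set_parent2 gi => fg.
  have := root_of_detach i ff; rewrite set_parent2 gi set_parentE eqxx => ->.
  have gii : g i = i by rewrite -gi set_parentE eqxx.
  by rewrite fg gii eqxx.
split; first by apply: forest_attach.
by rewrite -{2}gi set_parent_id.
Qed.

End ParentMaps.

(** * The matrix forest theorem *)

Section ForestSums.
Variables (T : finType) (R : comNzRingType).
Implicit Types (b : T -> T -> R) (f g : {ffun T -> T}) (i j k : T).

Definition parent_weight b f : R := \prod_(x | f x != x) b x (f x).

Definition forest_sum b : R := \sum_(f | is_forest f) parent_weight b f.

Definition rooted_sum b i j : R :=
  \sum_(f | is_forest f && (root_of f i == j)) parent_weight b f.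

Lemma parent_weight_attach b g i k : g i = i ->
  parent_weight b (set_parent g i k) =
  (if k == i then 1 else b i k) * parent_weight b g.
Proof.
move=> gi; rewrite /parent_weight big_mkcond [in RHS]big_mkcond (bigD1 i) //=.
rewrite [in RHS](bigD1 i) //= set_parentE eqxx gi eqxx mul1r if_neg.
congr (_ * _); apply: eq_bigr => x /negPf xi.
by rewrite set_parentE xi.
Qed.

Lemma big_forest_weight b i (Psi : {ffun T -> T} -> R) :
  \sum_(f | is_forest f) parent_weight b f * Psi f =
  \sum_(g | is_forest g && (g i == i)) parent_weight b g *
     (Psi g + \sum_(k | root_of g k != i) b i k * Psi (set_parent g i k)).
Proof.
rewrite (big_forest i); apply: eq_bigr => g /andP[fg /eqP gi].
rewrite (bigD1 i) ?eqxx //= parent_weight_attach // eqxx mul1r.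
rewrite -{2}gi set_parent_id mulrDr; congr (_ + _).
rewrite mulr_sumr; apply: eq_big => [k | k /andP[_ /negPf ki]].
  have [->|] //= := eqVneq k i; last by rewrite andbT.
  by rewrite root_of_fixed // eqxx.
by rewrite parent_weight_attach // ki -mulrA mulrCA.
Qed.

Lemma rooted_sumE b i j : rooted_sum b i j =
  \sum_(f | is_forest f) parent_weight b f * (root_of f i == j)%:R.
Proof.
rewrite /rooted_sum big_mkcondr; apply: eq_bigr => f _.
by case: eqP; rewrite (mulr1, mulr0).
Qed.

(** The contribution of a single forest g with root i to the identity below,
    where rho is the root function of g. The bracket Q l collects the
    forests obtained from g in which l has root j. Writing M and N for the
    sums of c over the vertices inside and outside the tree of i, both sides
    reduce to [i = j] (1 + N) since the sum of c is M + N. *)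
Lemma reroot_balance (c : T -> R) (rho : T -> T) i j :
  let U := \sum_(k | rho k != i) c k * (rho k == j)%:R in
  let Q l := (rho l == j)%:R + \sum_(k | rho k != i)
        c k * ((if rho l == i then rho k else rho l) == j)%:R in
  ((i == j)%:R + U) * (1 + \sum_k c k) - \sum_l c l * Q l =
  (i == j)%:R * (1 + \sum_(k | rho k != i) c k).
Proof.
move=> U Q; pose N := \sum_(k | rho k != i) c k.
pose M := \sum_(k | rho k == i) c k.
have sumE : \sum_k c k = M + N by rewrite (bigID (fun k => rho k == i)).
have Qin : \sum_(l | rho l == i) c l * Q l = M * ((i == j)%:R + U).
  rewrite mulr_suml; apply: eq_bigr => l li; rewrite /Q li (eqP li).
  by [].
have Qout : \sum_(l | rho l != i) c l * Q l = U + U * N.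
  rewrite mulr_suml -big_split /=; apply: eq_bigr => l li.
  rewrite /Q (negPf li) mulrDr; congr (_ + _).
  by rewrite -mulr_suml mulrA mulrAC.
rewrite [\sum_l c l * Q l](bigID (fun k => rho k == i)) /= Qin Qout sumE -/N.
by ring.
Qed.

(** The entry (i, j) of the matrix forest theorem. The loop weight b i i
    cancels from the left-hand side, in agreement with forests having no
    loops. *)
Theorem rooted_sum_balance b i j :
  rooted_sum b i j * (1 + \sum_k b i k) - \sum_k b i k * rooted_sum b k j =
  (i == j)%:R * forest_sum b.
Proof.
have rsE l : rooted_sum b l j =
  \sum_(g | is_forest g && (g i == i)) parent_weight b g *
    ((root_of g l == j)%:R + \sum_(k | root_of g k != i) b i k *
      ((if root_of g l == i then root_of g k else root_of g l) == j)%:R).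
  rewrite rooted_sumE (big_forest_weight _ i).
  apply: eq_bigr => g /andP[fg /eqP gi]; congr (_ * (_ + _)).
  apply: eq_bigr => k ki; congr (_ * (_ == _)%:R).
  by rewrite root_of_attach // ki orbT.
have fsE : forest_sum b = \sum_(g | is_forest g && (g i == i))
    parent_weight b g * (1 + \sum_(k | root_of g k != i) b i k).
  rewrite /forest_sum -(eq_bigr _ (fun f _ => mulr1 (parent_weight b f))).
  rewrite (big_forest_weight _ i); apply: eq_bigr => g _.
  by congr (_ * (_ + _)); apply: eq_bigr => k _; rewrite mulr1.
rewrite fsE mulr_sumr rsE mulr_suml.
under [X in _ - X]eq_bigr => k _ do rewrite rsE mulr_sumr.
rewrite exchange_big -sumrB; apply: eq_bigr => g /andP[fg /eqP gi].
rewrite [RHS]mulrCA -(reroot_balance (b i) (root_of g) i j) /=.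
rewrite root_of_fixed // eqxx mulrBr mulrA; congr (_ - _).
by rewrite mulr_sumr; apply: eq_bigr => k _; rewrite mulrCA.
Qed.

End ForestSums.

Section MatrixForest.
Variables (R : realType) (n : nat).
Implicit Type A : 'M[R]_n.

Definition rooted_mx A : 'M[R]_n := \matrix_(i, j) rooted_sum A i j.

Lemma laplacianE A i j :
  laplacian A i j = (i == j)%:R * (\sum_k A i k) - A i j.
Proof.
rewrite !mxE mulr_natl eq_sym; congr (_ *+ _ - _).
  by apply: eq_bigr => k _; rewrite mxE mulr1.
Qed.

Lemma laplacianZ a A : laplacian (a *: A) = a *: laplacian A.
Proof.
apply/matrixP => i j; rewrite [RHS]mxE !laplacianE mxE mulrBr; congr (_ - _).
rewrite mulrCA; congr (_ * _); rewrite mulr_sumr.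
by apply: eq_bigr => k _; rewrite mxE.
Qed.

Lemma laplacian_ones A : laplacian A *m ones = 0.
Proof.
apply/colP => i; rewrite !mxE.
under eq_bigr => k _ do rewrite laplacianE mxE mulr1.
rewrite sumrB -mulr_suml (bigD1 i) //= eqxx big1 ?addr0 ?mul1r ?subrr // => k.
by rewrite eq_sym => /negPf ->.
Qed.

Theorem matrix_forest A :
  (1%:M + laplacian A) *m rooted_mx A = (forest_sum A)%:M.
Proof.
apply/matrixP => i j; rewrite mxE [RHS]mxE -mulr_natl -rooted_sum_balance.
under eq_bigr => k _ do rewrite mxE laplacianE !mxE addrA mulrBl.
rewrite sumrB; congr (_ - _).
rewrite (bigD1 i) //= eqxx mul1r [X in _ + X]big1 => [|k].
  by rewrite addr0 mulrC.
by rewrite eq_sym => /negPf ->; rewrite mul0r addr0 mul0r.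
Qed.

End MatrixForest.

(** * Parent maps and sets of arcs *)

Section Arcs.
Variable T : finType.
Implicit Types (F : {set T * T}) (f : {ffun T -> T}) (i j r x y : T).

Definition arcs f : {set T * T} := [set e | (e.2 == f e.1) && (e.2 != e.1)]%SET.

Definition parent_of F : {ffun T -> T} :=
  [ffun x => if [pick y | arc F x y] is Some y then y else x].

Lemma arcsE f x y : arc (arcs f) x y = (y == f x) && (y != x).
Proof. by rewrite /arc inE. Qed.

Lemma arcsK : cancel arcs parent_of.
Proof.
move=> f; apply/ffunP => x; rewrite ffunE.
case: pickP => [y | none]; first by rewrite arcsE => /andP[/eqP].
by have := none (f x); rewrite arcsE eqxx /= => /negbFE/eqP.
Qed.

Lemma arcs_weight (R : comNzRingType) (b : T -> T -> R) f :
  \prod_(e in arcs f) b e.1 e.2 = parent_weight b f.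
Proof.
rewrite /parent_weight (reindex_onto (fun x => (x, f x)) fst) /=.
  by apply: eq_bigl => x; rewrite inE /= !eqxx andbT.
by move=> [x y]; rewrite inE /= => /andP[/eqP ->].
Qed.

(** The root is constant along arcs, hence on weak components; conversely
    two vertices with the same root are joined through it. *)
Lemma mem_weak_component_arcs f i j : is_forest f ->
  (j \in weak_component (arcs f) i) = (root_of f i == root_of f j).
Proof.
move=> ff; rewrite inE; set e := (fun _ _ => _).
have e_sym : symmetric e by move=> x y; rewrite /e orbC.
have to_root x : connect e x (root_of f x).
  have: fconnect f x (root_of f x) by apply: fconnect_iter.
  apply: connect_sub => {}x y /= /eqP <-.
  have [->|fx] := eqVneq (f x) x; first exact: connect0.
  by apply: connect1; rewrite /e arcsE eqxx fx.
apply/idP/eqP => [|eq_r].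
  have cl : fingraph.closed e [pred y | root_of f y == root_of f i].
    apply: (intro_closed (sym_connect_sym e_sym)) => x y exy.
    rewrite !inE => /eqP <-; apply/eqP.
    by case/orP: exy; rewrite arcsE => /andP[/eqP -> _]; rewrite root_of_step.
  by move=> /(closed_connect cl); rewrite !inE eqxx => /esym/eqP.
apply: connect_trans (to_root i) _; rewrite eq_r.
by rewrite (sym_connect_sym e_sym).
Qed.

(** In a deterministic relation two paths from x can only differ in length; the
    shorter one could not stop at a vertex with a successor. *)
Lemma path_to_sink_uniq (e : rel T) r x p q :
  (forall x y z, e x y -> e x z -> y = z) -> (forall y, ~~ e r y) ->
  path e x p -> last x p = r -> path e x q -> last x q = r -> p = q.
Proof.
move=> det sink; elim: p x q => [|y p IHp] x [|z q] //=.
- by move=> _ -> /andP[]; rewrite (negPf (sink _)).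
- by move=> /andP[+ _] _ _ xr; rewrite xr (negPf (sink _)).
move=> /andP[exy yp] lp /andP[exz zq] lq; move: zq lq.
by rewrite -(det _ _ _ exy exz) => zq lq; congr (_ :: _); apply: (IHp y).
Qed.

Lemma in_tree_arcs f i r : is_forest f ->
  in_tree_with_root (arcs f) i r <-> root_of f i = r.
Proof.
move=> ff; rewrite /in_tree_with_root; set C := weak_component _ i.
set E := restrict _ C.
have inC j : (j \in C) = (root_of f i == root_of f j).
  exact: mem_weak_component_arcs.
have arcE x y : arc E x y = [&& y == f x, y != x & x \in C].
  rewrite /arc /E /restrict inE finset.in_setX /=.
  rewrite -/(arc (arcs f) x y) arcsE -!andbA.
  have [->|] //= := eqVneq y (f x); congr (_ && _).
  by rewrite [f x \in C]inC root_of_step // -inC andbb.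
have det x y z : arc E x y -> arc E x z -> y = z.
  by rewrite !arcE => /and3P[/eqP -> _ _] /and3P[/eqP ->].
split=> [[rC _ _ r0] | <-{r}].
  have fr : f r = r.
    apply/eqP; apply: contraT => frr.
    move/eqP: r0; rewrite cards_eq0 => /eqP/setP/(_ (f r)).
    by rewrite !inE arcE eqxx frr rC.
  by move: rC; rewrite inC => /eqP ->; apply: root_of_fixed.
set r := root_of f i.
have fr : f r = r by apply: root_ofK.
have rC : r \in C by rewrite inC -/r root_of_fixed.
have sink y : ~~ arc E r y by rewrite arcE fr; case: eqP.
split=> //.
- move=> j jC.
  have : connect (arc E) j r.
    have : fconnect f j r.
      by move: jC; rewrite inC -/r => /eqP ->; apply: fconnect_iter.
    case/iter_findex; move: (findex _ _ _) => m.
    elim: m j jC => [|m IHm] j jC; first by move=> /= <-; apply: connect0.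
    rewrite iterSr => jr.
    have fjC : f j \in C by rewrite inC root_of_step // -inC.
    apply: connect_trans (IHm _ fjC jr).
    have [->|fj] := eqVneq (f j) j; first exact: connect0.
    by apply: connect1; rewrite arcE eqxx fj.
  case/connectP => p0 /shortenP[p jp up _] lp; exists p; split.
    by split.
  by move=> q [jq lq _]; apply: path_to_sink_uniq det sink jp _ jq lq.
- move=> j jC jr; rewrite /outdegree.
  have fj : f j != j.
    apply: contra jr => /eqP fj; move: jC; rewrite inC -/r => /eqP ->.
    by rewrite root_of_fixed.
  rewrite -(cards1 (f j)); congr #|pred_of_set _|.
  apply/setP => y; rewrite !inE arcE jC andbT.
  by have [->|] := eqVneq y (f j).
apply/eqP; rewrite cards_eq0; apply/eqP/setP => y.
by rewrite !inE (negPf (sink y)).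
Qed.

Lemma in_forest_arcs (G : {set T * T}) f : is_forest f ->
  in_forest G (arcs f) <-> arcs f \subset G.
Proof.
move=> ff; split=> [[]// | sub]; split=> // i.
by exists (root_of f i); apply/in_tree_arcs.
Qed.

Lemma weak_componentP F i x y :
  x \in weak_component F i -> arc F x y -> y \in weak_component F i.
Proof.
rewrite !inE => ix xy; apply: connect_trans ix _.
by apply: connect1; rewrite xy.
Qed.

(** Every vertex is compared inside its own weak component, which contains
    all of its out-neighbours. There the degree conditions leave at most one
    arc out of a vertex, and the path to the root cannot be free of
    repetitions if it starts with a loop. *)
Lemma forest_of_arcs F : (forall i, exists r, in_tree_with_root F i r) ->
  arcs (parent_of F) = F /\ is_forest (parent_of F).
Proof.
move=> treeF; set f := parent_of F.
have selfC i : i \in weak_component F i by rewrite inE connect0.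
have arcC i x y : x \in weak_component F i -> arc F x y ->
    arc (restrict F (weak_component F i)) x y.
  move=> xC xy; rewrite /arc /restrict inE finset.in_setX /= xC.
  rewrite (weak_componentP xC xy).
  by rewrite -/(arc F x y) xy.
have parentE x y : arc F x y -> f x = y /\ y != x.
  move=> xy; have [r [rC path_r out1 out0]] := treeF x.
  have xy' := arcC _ _ _ (selfC x) xy.
  have xr : x != r.
    apply: contraTneq xy' => xr; rewrite {2}xr.
    move/eqP: out0; rewrite cards_eq0 => /eqP/setP/(_ y).
    by rewrite !inE => ->.
  have /eqP/cards1P[z outE] := out1 _ (selfC x) xr.
  have yz w : arc F x w -> w = z.
    move=> /(arcC _ _ _ (selfC x)) xw.
    by move/setP/(_ w): outE; rewrite !inE xw => /esym/eqP.
  split.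
    rewrite ffunE; case: pickP => [w /yz -> | /(_ y)]; last by rewrite xy.
    by rewrite (yz y).
  have [p [[xp lp up] _]] := path_r x (selfC x).
  case: p xp lp up => [|w p] /=; first by move=> _ /eqP; rewrite (negPf xr).
  move=> /andP[xw _] _ /andP[+ _]; apply: contra => /eqP yx.
  have <- : y = w.
    by rewrite (yz y) // (yz w) //; move: xw; rewrite /arc inE => /andP[].
  by rewrite yx mem_head.
split.
  apply/setP => [[x y]]; rewrite inE /=; apply/andP/idP => [[/eqP -> ]|xy].
    by rewrite ffunE; case: pickP => [z //|]; rewrite eqxx.
  by have [-> yx] := parentE _ _ xy.
apply/is_forestP => x; have [r [rC path_r _ out0]] := treeF x.
exists r.
  have [p [[xp lp _] _]] := path_r x (selfC x).
  have /connect_sub : forall y z, arc (restrict F (weak_component F x)) y z ->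
      fconnect f y z.
    move=> y z; rewrite /arc inE => /andP[yz _]; apply: connect1 => /=.
    by have [-> _] := parentE _ _ yz.
  by apply; apply/connectP; exists p.
rewrite ffunE; case: pickP => // y ry.
move/eqP: out0; rewrite cards_eq0 => /eqP/setP/(_ y).
by rewrite !inE (arcC _ _ _ rC ry).
Qed.

End Arcs.

(** * Limits of matrices *)

Section FilterLimits.
Variables (R : realType) (T : Type) (F : set_system T).
Context {FF : Filter F}.

Lemma cvg_bigsum (I : Type) (r : seq I) (P : pred I)
    (f : I -> T -> R) (l : I -> R) :
  (forall i, P i -> f i x @[x --> F] --> l i) ->
  \sum_(i <- r | P i) f i x @[x --> F] --> \sum_(i <- r | P i) l i.
Proof.
move=> fl; elim: r => [|i r IHr].
  by rewrite big_nil; under eq_fun do rewrite big_nil; apply: cvg_cst.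
rewrite big_cons; under eq_fun do rewrite big_cons.
by case: ifP => // Pi; apply: cvgD => //; apply: fl.
Qed.

Lemma cvg_mxP m n (f : T -> 'M[R]_(m, n)) (M : 'M[R]_(m, n)) :
  f x @[x --> F] --> M <-> forall i j, f x i j @[x --> F] --> M i j.
Proof.
split=> [fM i j | fM].
  apply: (@cvg_comp _ _ _ f (fun N : 'M[R]_(m, n) => N i j) _ _ _ fM).
  exact: coord_continuous.
move=> B [P MP PB].
suff : \forall x \near F, forall i j, P i j (f x i j).
  by apply: filterS => x; apply: PB.
by apply: filter_forall => i; apply: filter_forall => j; apply: fM; apply: MP.
Qed.

Lemma cvg_mulmx m n p (f : T -> 'M[R]_(m, n)) (g : T -> 'M[R]_(n, p))
    (M : 'M[R]_(m, n)) (N : 'M[R]_(n, p)) :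
  f x @[x --> F] --> M -> g x @[x --> F] --> N ->
  f x *m g x @[x --> F] --> M *m N.
Proof.
move=> /cvg_mxP fM /cvg_mxP gN; apply/cvg_mxP => i j; rewrite mxE.
under eq_fun do rewrite mxE.
by apply: cvg_bigsum => k _; apply: cvgM.
Qed.

End FilterLimits.

(** * Maximum in-forests *)

Section MaximumForests.
Variables (R : realType) (n : nat) (A : 'M[R]_n).
Hypothesis A_ge0 : forall i j, 0 <= A i j.
Implicit Type f : {ffun 'I_n -> 'I_n}.

Lemma parent_weight_ge0 f : 0 <= parent_weight A f.
Proof. exact: prodr_ge0. Qed.

Lemma parent_weight_gt0 f :
  (0 < parent_weight A f) = (arcs f \subset dependency_digraph A).
Proof.
rewrite -arcs_weight lt0r prodr_ge0 // andbT; apply/prodf_neq0/fintype.subsetP.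
  by move=> Af e /Af Ae; rewrite inE lt0r Ae A_ge0.
by move=> sub e /sub; rewrite inE lt0r => /andP[].
Qed.

Lemma forest_sum_gt0 : 0 < forest_sum A.
Proof.
pose f0 := [ffun i : 'I_n => i].
have ff0 : is_forest f0.
  apply/is_forestP => x; exists x; first exact: connect0.
  by rewrite ffunE.
rewrite /forest_sum (bigD1 f0) //=; apply: ltr_wpDr.
  by apply: sumr_ge0 => f _; apply: parent_weight_ge0.
by rewrite /parent_weight big1 // => x; rewrite ffunE eqxx.
Qed.

(** The condition 0 < parent_weight A f expresses that f only uses arcs of
    the dependency digraph; forests with other arcs have weight zero, so
    that they may be kept in the sums below. *)
Definition max_arcs : nat :=
  \max_(f : {ffun 'I_n -> 'I_n} | is_forest f && (0 < parent_weight A f))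
    #|arcs f|.

Lemma card_arcs_le f : is_forest f -> 0 < parent_weight A f ->
  (#|arcs f| <= max_arcs)%N.
Proof.
move=> ff wf; rewrite /max_arcs; apply: (bigop.leq_bigmax_cond f).
by rewrite ff wf.
Qed.

Lemma max_arcs_witness :
  exists f, [/\ is_forest f, 0 < parent_weight A f & #|arcs f| = max_arcs].
Proof.
have [f ff wf] : exists2 f, is_forest f & 0 < parent_weight A f.
  have := forest_sum_gt0; rewrite lt0r => /andP[ne0 _].
  apply: contrapT => no; move/eqP: ne0; apply; apply: big1 => f ff.
  apply/eqP; apply: contraT => wf; case: no; exists f => //.
  by rewrite lt0r wf parent_weight_ge0.
pose P := [pred f : {ffun 'I_n -> 'I_n} | is_forest f & 0 < parent_weight A f].
have [|g /andP[fg wg] arcs_g] := @eq_bigmax_cond _ P (fun f => #|arcs f|).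
  by apply/card_gt0P; exists f; rewrite inE ff wf.
by exists g.
Qed.

Lemma maximum_in_forest_arcs f : is_forest f ->
  maximum_in_forest (dependency_digraph A) (arcs f) <->
  0 < parent_weight A f /\ #|arcs f| = max_arcs.
Proof.
move=> ff; rewrite /maximum_in_forest in_forest_arcs // -parent_weight_gt0.
split=> [[wf fmax] | [wf cf]]; split=> //.
  apply/eqP; rewrite eqn_leq; apply/andP; split.
    exact: card_arcs_le.
  have [g [fg wg <-]] := max_arcs_witness; apply: fmax.
  by apply/in_forest_arcs => //; rewrite -parent_weight_gt0.
move=> F' [sub treeF]; rewrite cf.
have [FE fF] := forest_of_arcs treeF; rewrite -FE.
by apply: card_arcs_le => //; rewrite parent_weight_gt0 FE.
Qed.

Definition maximum_sum (P : pred {ffun 'I_n -> 'I_n}) : R :=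
  \sum_(f | is_forest f && P f) (#|arcs f| == max_arcs)%:R * parent_weight A f.

Lemma big_maximum_in_forest (Q : {set 'I_n * 'I_n} -> Prop)
    (P : pred {ffun 'I_n -> 'I_n}) :
  (forall f, is_forest f -> Q (arcs f) <-> P f) ->
  \sum_(F : {set 'I_n * 'I_n} |
       `[< maximum_in_forest (dependency_digraph A) F /\ Q F >])
    forest_weight A F = maximum_sum P.
Proof.
move=> QP; rewrite (reindex_onto (@arcs _) (@parent_of _)) /=; last first.
  by move=> F /asboolP[[[_ /forest_of_arcs[-> _]] _] _].
rewrite /maximum_sum [RHS](bigID (fun f => 0 < parent_weight A f)) /=.
rewrite [X in _ = _ + X]big1 => [|f /andP[_ wf]]; last first.
  have /eqP -> : parent_weight A f == 0.
    by move: wf; rewrite lt0r parent_weight_ge0 andbT negbK.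
  by rewrite mulr0.
rewrite addr0 [RHS]big_mkcond [LHS]big_mkcond; apply: eq_bigr => f _.
rewrite arcsK eqxx andbT {1}/forest_weight arcs_weight.
case: asboolP => [[maxf Qf] | nmax].
  have ff : is_forest f.
    by have [[_ /forest_of_arcs[_]]] := maxf; rewrite arcsK.
  have [wf cf] := (maximum_in_forest_arcs ff).1 maxf.
  by rewrite ff wf cf eqxx ((QP f ff).1 Qf) mul1r.
case: ifP => // /andP[/andP[ff Pf] wf].
have [cf|] := eqVneq #|arcs f| max_arcs; last by rewrite mul0r.
case: nmax; split; last exact/QP.
exact/maximum_in_forest_arcs.
Qed.

Lemma maximum_sum_gt0 : 0 < maximum_sum predT.
Proof.
have [f [ff wf cf]] := max_arcs_witness.
rewrite /maximum_sum (bigD1 f) /= ?ff // cf eqxx mul1r; apply: ltr_wpDr => //.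
by apply: sumr_ge0 => g _; rewrite mulr_ge0 ?ler0n ?parent_weight_ge0.
Qed.

Lemma JbarE i j :
  Jbar A i j = maximum_sum (fun f => root_of f i == j) / maximum_sum predT.
Proof.
rewrite mxE; congr (_ / _).
  apply: big_maximum_in_forest => f ff.
  by rewrite in_tree_arcs //; split=> /eqP.
rewrite -(big_maximum_in_forest (Q := fun=> True)) //.
apply: eq_bigl => F; apply/asboolP/asboolP; last by case.
by [].
Qed.

End MaximumForests.

Section ScaledForests.
Variables (R : realType) (n : nat) (A : 'M[R]_n).
Hypothesis A_ge0 : forall i j, 0 <= A i j.
Implicit Type f : {ffun 'I_n -> 'I_n}.

Lemma parent_weightZ a f :
  parent_weight (a *: A) f = a ^+ #|arcs f| * parent_weight A f.
Proof.
rewrite -!arcs_weight -prodr_const -big_split /=.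
by apply: eq_bigr => e _; rewrite mxE.
Qed.

Lemma scaled_weight (d : R) f : 0 < d -> is_forest f ->
  d ^+ max_arcs A * parent_weight (d^-1 *: A) f =
  d ^+ (max_arcs A - #|arcs f|) * parent_weight A f.
Proof.
move=> d0 ff; rewrite parent_weightZ mulrA exprVn.
have [wf0|wf0] := eqVneq (parent_weight A f) 0; first by rewrite wf0 !mulr0.
congr (_ * _); rewrite -expfB_cond ?gt_eqF //.
by apply: card_arcs_le => //; rewrite lt0r wf0 parent_weight_ge0.
Qed.

(** Multiplied by d to the power max_arcs A, the weight of a forest with k
    arcs for the matrix A / d is a multiple of d to the power max_arcs A
    - k. As d tends to 0 only the forests with max_arcs A arcs survive. *)
Lemma cvg_scaled_sum (P : pred {ffun 'I_n -> 'I_n}) :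
  d ^+ max_arcs A *
    (\sum_(f | is_forest f && P f) parent_weight (d^-1 *: A) f)
  @[d --> 0^'+] --> maximum_sum A P.
Proof.
pose S d : R := \sum_(f | is_forest f && P f)
   d ^+ (max_arcs A - #|arcs f|) * parent_weight A f.
have Slim : S d @[d --> 0^'+] --> maximum_sum A P.
  apply: cvg_bigsum => f /andP[ff _].
  have [wf0|wf0] := eqVneq (parent_weight A f) 0.
    by rewrite wf0 mulr0; under eq_fun do rewrite mulr0; apply: cvg_cst.
  apply: cvgM; last exact: cvg_cst.
  have -> : (#|arcs f| == max_arcs A)%:R = 0 ^+ (max_arcs A - #|arcs f|) :> R.
    rewrite expr0n subn_eq0 eqn_leq; congr (_%:R); congr nat_of_bool.
    have -> // : (#|arcs f| <= max_arcs A)%N.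
    by apply: card_arcs_le => //; rewrite lt0r wf0 parent_weight_ge0.
  apply: cvg_at_right_filter; exact: exprn_continuous.
apply: cvg_trans Slim; apply: near_eq_cvg; near=> d.
rewrite mulr_sumr; apply: eq_bigr => f /andP[ff _].
by rewrite scaled_weight //.
Unshelve. all: by end_near. Qed.

End ScaledForests.

(** * The limit of the resolvent *)

Section Resolvent.
Variables (R : realType) (n : nat) (A : 'M[R]_n).
Hypothesis A_ge0 : forall i j, 0 <= A i j.

Lemma resolvent_forest :
  (1%:M + laplacian A) \in unitmx /\
  invmx (1%:M + laplacian A) = (forest_sum A)^-1 *: rooted_mx A.
Proof.
have s0 : forest_sum A != 0 by rewrite gt_eqF ?forest_sum_gt0.
have inv : (1%:M + laplacian A) *m ((forest_sum A)^-1 *: rooted_mx A) = 1%:M.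
  by rewrite -scalemxAr matrix_forest scale_scalar_mx mulVf.
have [unit _] := mulmx1_unit inv; split=> //.
by rewrite -[RHS](mulKmx unit) inv mulmx1.
Qed.

End Resolvent.

Section Eigenprojection.
Variables (R : realType) (n : nat) (A : 'M[R]_n).
Hypothesis A_ge0 : forall i j, 0 <= A i j.

Definition resolvent (d : R) : 'M[R]_n := invmx (1%:M + d^-1 *: laplacian A).

Lemma scaled_ge0 (d : R) : 0 < d -> forall i j, 0 <= (d^-1 *: A) i j.
Proof. by move=> d0 i j; rewrite mxE mulr_ge0 // invr_ge0 ltW. Qed.

Lemma resolvent_unit (d : R) : 0 < d ->
  (1%:M + d^-1 *: laplacian A) \in unitmx.
Proof.
move=> d0; rewrite -laplacianZ.
by have [] := resolvent_forest (scaled_ge0 d0).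
Qed.

Lemma resolvent_ones (d : R) : 0 < d -> resolvent d *m ones = ones.
Proof.
move=> d0; rewrite -[in RHS](mulKmx (resolvent_unit d0) ones).
by rewrite mulmxDl mul1mx -scalemxAl laplacian_ones scaler0 addr0.
Qed.

(** The entries of the resolvent are quotients of forest sums for A / d;
    after multiplication of both terms by the same power of d, they tend to
    sums over the maximum forests, and the limit of the denominator is
    positive. *)
Lemma cvg_resolvent : resolvent d @[d --> 0^'+] --> Jbar A.
Proof.
apply/cvg_mxP => i j; rewrite JbarE //.
pose S (P : pred {ffun 'I_n -> 'I_n}) (d : R) := d ^+ max_arcs A *
    (\sum_(f | is_forest f && P f) parent_weight (d^-1 *: A) f).
have ratio : S (fun f => root_of f i == j) d / S predT d @[d --> 0^'+] -->
    maximum_sum A (fun f => root_of f i == j) / maximum_sum A predT.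
  apply: cvgM; first exact: cvg_scaled_sum.
  by apply: cvgV; [rewrite gt_eqF ?maximum_sum_gt0 | exact: cvg_scaled_sum].
apply: cvg_trans ratio; apply: near_eq_cvg; near=> d.
rewrite /resolvent -laplacianZ (resolvent_forest (scaled_ge0 _)).2 // !mxE.
rewrite /S -mulf_div divff ?mul1r ?expf_neq0 ?gt_eqF // [RHS]mulrC.
congr (_ / _).
by apply: eq_bigl => f; rewrite andbT.
Unshelve. all: by end_near. Qed.

Lemma Jbar_ones : Jbar A *m ones = ones.
Proof.
have lim1 : resolvent d *m ones @[d --> 0^'+] --> Jbar A *m (ones : 'cV[R]_n).
  by apply: cvg_mulmx; [exact: cvg_resolvent | exact: cvg_cst].
apply: (cvg_unique _ lim1); first exact: norm_hausdorff.
have lim2 : (ones : 'cV[R]_n) @[_ --> (0 : R)^'+] --> (ones : 'cV[R]_n).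
  exact: cvg_cst.
apply: cvg_trans lim2; apply: near_eq_cvg; near=> d.
by rewrite resolvent_ones.
Unshelve. all: by end_near. Qed.

(** If X is the resolvent then X L = d (I - X), where X has a limit as d
    tends to 0. *)
Lemma Jbar_laplacian : Jbar A *m laplacian A = 0.
Proof.
have lim1 : resolvent d *m laplacian A @[d --> 0^'+] --> Jbar A *m laplacian A.
  by apply: cvg_mulmx; [exact: cvg_resolvent | exact: cvg_cst].
apply: (cvg_unique _ lim1); first exact: norm_hausdorff.
have d0 : (d : R) @[d --> 0^'+] --> (0 : R).
  by apply: cvg_at_right_filter; apply: cvg_id.
have lim0 : d *: (1%:M - resolvent d) @[d --> 0^'+] --> (0 : 'M[R]_n).
  rewrite -[X in _ --> X](scale0r (1%:M - Jbar A)).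
  by apply: cvgZ => //; apply: cvgB; [exact: cvg_cst | exact: cvg_resolvent].
apply: cvg_trans lim0; apply: near_eq_cvg; near=> d.
have /mulVmx : (1%:M + d^-1 *: laplacian A) \in unitmx by exact: resolvent_unit.
rewrite -/(resolvent d) mulmxDr mulmx1 => <-.
by rewrite addrC addKr -scalemxAr scalerA divff ?scale1r ?gt_eqF.
Unshelve. all: by end_near. Qed.

End Eigenprojection.

(** * A maximum principle for linear differential inequalities *)

Section MaximumPrinciple.
Variable R : realType.

Lemma is_derive_cvg (V : normedModType R) (f : R -> V) (t : R) (df : V) :
  is_derive t 1 f df ->
  h^-1 *: (f (h *: (1 : R) + t) - f t) @[h --> 0^'] --> df.
Proof. by case=> dvbl <-. Qed.

Lemma derive_ge0_left_max (f : R -> R) (t df : R) : 0 < t ->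
  is_derive t 1 f df -> (forall s, 0 <= s <= t -> f s <= f t) -> 0 <= df.
Proof.
move=> t0 f_df f_max; rewrite leNgt; apply/negP => df0.
have quot : h^-1 *: (f (h *: (1 : R) + t) - f t) @[h --> 0^'-] --> df.
  exact/cvg_dnbhs_at_left/is_derive_cvg.
have lt0 : \forall h \near (0 : R)^'-,
  h^-1 *: (f (h *: (1 : R) + t) - f t) < 0 by exact: cvgr_lt quot _ df0.
have /filter_ex[h [h0 th]] : \forall h \near (0 : R)^'-, [/\ h < 0, 0 <= h + t
    & h^-1 *: (f (h *: (1 : R) + t) - f t) < 0].
  near=> h; split=> //; last by near: h.
  by rewrite -lerBlDr sub0r; near: h; apply: nbhs_left_ge; rewrite oppr_lt0.
apply/negP; rewrite -leNgt /GRing.scale /= mulr1.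
apply: mulr_le0; first by rewrite invr_le0 ltW.
by rewrite subr_le0 f_max // th gerDr ltW.
Unshelve. all: by end_near. Qed.

(** If some f i exceeded m at time T by more than e, the functions f i s -
    (e / T) s would attain their common maximum over i and over [0, T] at
    some i and some time t > 0. There f i is the largest of the f j, so that
    its derivative is at most 0, while a maximum at t requires it to be at
    least e / T. *)
Lemma maximum_principle (I : finType) (f df : I -> R -> R) (m : R) :
  (forall i (t : R), 0 < t -> is_derive t 1 (f i) (df i t)) ->
  (forall i, f i h @[h --> 0^'+] --> f i 0) ->
  (forall i (t : R), 0 < t -> (forall j, f j t <= f i t) -> df i t <= 0) ->
  (forall i, f i 0 <= m) ->
  forall i (t : R), 0 <= t -> f i t <= m.
Proof.
move=> f_df f_0 df_le0 f_m i0 T; rewrite le_eqVlt => /predU1P[<- //|T0].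
apply/ler_addgt0Pr => e e0.
pose g i s := f i s - e / T * s.
have g_df i (t : R) : 0 < t -> is_derive t 1 (g i) (df i t - e / T).
  move=> t0; have fd := f_df i t t0.
  rewrite -[X in df i t - X]mulr1.
  exact: (is_deriveB fd (is_deriveZ (e / T) (is_derive_id t 1))).
have g_cont i : {within `[0, T], continuous (g i)}.
  have at_pos (t : R) : 0 < t -> {for t, continuous (g i)}.
    move=> t0; apply: differentiable_continuous; apply/derivable1_diffP.
    exact: (@ex_derive _ _ _ _ _ _ _ (g_df i t t0)).
  apply/continuous_within_itvP => //; split.
  - by move=> t; rewrite in_itv /= => /andP[/at_pos].
  - apply: cvgB => //; apply: cvgM; first exact: cvg_cst.
    by apply: cvg_at_right_filter; apply: cvg_id.
  - by apply: cvg_at_left_filter; apply: at_pos.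
have gmax i : {c | c \in `[0, T] & forall t, t \in `[0, T] -> g i t <= g i c}.
  have [c cT gc] := cid2 (EVT_max (ltW T0) (g_cont i)).
  by exists c.
pose c i := s2val (gmax i).
have c_itv i : 0 <= c i <= T by have := s2valP (gmax i); rewrite in_itv.
have g_c i t : 0 <= t <= T -> g i t <= g i (c i).
  by move=> tT; apply: (s2valP' (gmax i)); rewrite in_itv.
pose k := [arg max_(i > i0) g i (c i)]%O.
have g_k i t : 0 <= t <= T -> g i t <= g k (c k).
  move=> /g_c /le_trans; apply; rewrite /k.
  by case: Order.TotalTheory.arg_maxP => // j _; apply.
have : g i0 T <= g k (c k) by apply: g_k; rewrite ltW //= lexx.
rewrite {1}/g divfK ?gt_eqF // lerBlDr => /le_trans; apply; rewrite lerD2r.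
have [ck0|ck0] := eqVneq (c k) 0; first by rewrite ck0 /g mulr0 subr0.
have ck_gt0 : 0 < c k by rewrite lt0r ck0; have /andP[] := c_itv k.
have : 0 <= df k (c k) - e / T.
  apply: (derive_ge0_left_max ck_gt0 (g_df k _ ck_gt0)) => s /andP[s0 sc].
  by apply: g_k; rewrite s0 (le_trans sc) //; have /andP[] := c_itv k.
rewrite subr_ge0 => /le_trans /(_ (df_le0 k _ ck_gt0 _)) contra.
have : e / T <= 0.
  by apply: contra => j; have := g_k j _ (c_itv k); rewrite /g lerD2r.
by rewrite leNgt divr_gt0.
Qed.

End MaximumPrinciple.

(** * Trajectories of linear systems *)

Section Trajectories.
Variable R : realType.

(** Weaker than ode_solution at time 0, where only right continuity is kept:
    this form is stable under linear maps and suffices for the maximum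
    principle. *)
Definition trajectory n (M : 'M[R]_n) (x : R -> 'cV[R]_n) : Prop :=
  (forall t : R, 0 < t -> is_derive t 1 x (M *m x t)) /\
  x h @[h --> 0^'+] --> x 0.

Lemma ode_solution_trajectory n (M : 'M[R]_n) x :
  ode_solution M x -> trajectory M x.
Proof.
move=> [dx dx0]; split=> //.
have h0 : (h : R) @[h --> 0^'+] --> (0 : R).
  by apply: cvg_at_right_filter; apply: cvg_id.
have lim0 : x 0 + h *: (h^-1 *: (x h - x 0)) @[h --> 0^'+] --> x 0.
  rewrite -[X in _ --> X]addr0 -(scale0r (M *m x 0)).
  by apply: cvgD; [exact: cvg_cst | apply: cvgZ].
apply: cvg_trans lim0; apply: near_eq_cvg; near=> h.
by rewrite scalerA divff ?gt_eqF // scale1r addrC subrK.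
Unshelve. all: by end_near. Qed.

Lemma trajectory_mulmx n p (N : 'M[R]_(p, n)) (M : 'M[R]_n) (M' : 'M[R]_p) x :
  N *m M = M' *m N -> trajectory M x -> trajectory M' (fun t => N *m x t).
Proof.
move=> NM [dx x0]; split=> [t t0|]; last first.
  by apply: cvg_mulmx => //; exact: cvg_cst.
have dxt := dx t t0.
have quot : h^-1 *: (N *m x (h *: (1 : R) + t) - N *m x t) @[h --> 0^'] -->
    M' *m (N *m x t).
  rewrite mulmxA -NM -mulmxA.
  under eq_fun do rewrite -mulmxBr scalemxAr.
  by apply: cvg_mulmx; [exact: cvg_cst | exact: is_derive_cvg].
apply: DeriveDef; first by apply/cvg_ex; eexists; exact: quot.
by apply: cvg_lim quot; exact: norm_hausdorff.
Qed.

Lemma trajectory_coord n (M : 'M[R]_n) x i : trajectory M x ->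
  (forall t : R, 0 < t -> is_derive t 1 (fun s => x s i 0) ((M *m x t) i 0)) /\
  x h i 0 @[h --> 0^'+] --> x 0 i 0.
Proof.
move=> [dx x0]; split=> [t t0|]; last by move/cvg_mxP: x0; apply.
have dxt := dx t t0; have ext := @ex_derive _ _ _ _ _ _ _ dxt.
apply: DeriveDef; first by move/derivable_mxP: ext.
by rewrite -(@derive_val _ _ _ _ _ _ _ dxt) derive_mx // mxE.
Qed.

Lemma laplacian_mulE n (A : 'M[R]_n) (y : 'cV[R]_n) i :
  (laplacian A *m y) i 0 = \sum_k A i k * (y i 0 - y k 0).
Proof.
rewrite mxE; under eq_bigr => k _ do rewrite laplacianE mulrBl.
under [RHS]eq_bigr => k _ do rewrite mulrBr.
rewrite !sumrB; congr (_ - _).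
rewrite (bigD1 i) //= eqxx mul1r mulr_suml [X in _ + X]big1 ?addr0 // => k.
by rewrite eq_sym => /negPf ->; rewrite !mul0r.
Qed.

(** The coordinates of exp (d t) y follow the flow of - L. A largest
    coordinate does not increase under that flow, because row i of L y is
    the sum of the a_ik (y_i - y_k). *)
Lemma trajectory_decay_le n (A : 'M[R]_n) (d m : R) (y : R -> 'cV[R]_n) :
  (forall i j, 0 <= A i j) -> trajectory (- (laplacian A + d%:M)) y ->
  (forall i, y 0 i 0 <= m) ->
  forall i (t : R), 0 <= t -> expR (d * t) * y t i 0 <= m.
Proof.
move=> A_ge0 y_traj y0.
pose f i s := expR (d * s) * y s i 0.
pose df i s := - (expR (d * s) * (laplacian A *m y s) i 0).
apply: (maximum_principle (f := f) (df := df)) => [i t t0|i|i t t0 ymax|i].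
- have [/(_ t t0) dy _] := trajectory_coord i y_traj.
  have dexp : is_derive t 1 (fun s => expR (d * s)) (d * expR (d * t)).
    have dlin : is_derive t 1 (d \*: id) (d *: (1 : R)) by exact: is_deriveZ.
    rewrite -[X in X * _]mulr1 mulrC.
    exact: (is_derive1_comp (is_derive_expR (d * t)) dlin).
  apply: (is_derive_eq (is_deriveM dexp dy)).
  have -> : (- (laplacian A + d%:M) *m y t) i 0 =
      - (laplacian A *m y t) i 0 - d * y t i 0.
    rewrite mulNmx mulmxDl mul_scalar_mx mxE [in LHS]mxE opprD.
    by congr (_ - _); rewrite mxE.
  by rewrite /df /GRing.scale /=; ring.
- have [_ y_0] := trajectory_coord i y_traj.
  apply: cvgM => //; apply: cvg_at_right_filter.
  apply: (@continuous_comp _ _ _ (fun s => d * s) expR).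
    exact: mulrl_continuous.
  exact: continuous_expR.
- rewrite /df oppr_le0 mulr_ge0 ?expR_ge0 // laplacian_mulE.
  apply: sumr_ge0 => k _; rewrite mulr_ge0 // subr_ge0.
  by have := ymax k; rewrite /f ler_pM2l ?expR_gt0.
- by rewrite /f mulr0 expR0 mul1r.
Qed.

Lemma trajectoryN n (M : 'M[R]_n) y :
  trajectory M y -> trajectory M (fun t => - y t).
Proof.
move=> y_traj; have := @trajectory_mulmx n n (- 1%:M) M M y.
under eq_fun do rewrite mulNmx mul1mx.
by apply; rewrite // mulNmx mulmxN mulmx1 mul1mx.
Qed.

Lemma trajectory_decay_norm_le n (A : 'M[R]_n) (d : R) (y : R -> 'cV[R]_n) :
  (forall i j, 0 <= A i j) -> trajectory (- (laplacian A + d%:M)) y ->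
  forall i (t : R), 0 <= t -> expR (d * t) * `|y t i 0| <= \sum_k `|y 0 k 0|.
Proof.
move=> A_ge0 y_traj i t t0.
have le_sum k : `|y 0 k 0| <= \sum_l `|y 0 l 0|.
  by rewrite (bigD1 k) //= lerDl sumr_ge0.
have upper := trajectory_decay_le A_ge0 y_traj
  (fun k => le_trans (ler_norm _) (le_sum k)) i t0.
have lower : expR (d * t) * (- y t) i 0 <= \sum_l `|y 0 l 0|.
  apply: (trajectory_decay_le A_ge0 (trajectoryN y_traj)) t0 => k.
  by rewrite mxE (le_trans _ (le_sum k)) // -normrN ler_norm.
by move: upper lower; rewrite mxE; case: (ger0P (y t i 0)).
Qed.

Lemma trajectory_cvg0 n (A : 'M[R]_n) (d : R) (y : R -> 'cV[R]_n) :
  (forall i j, 0 <= A i j) -> 0 < d ->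
  trajectory (- (laplacian A + d%:M)) y -> y t @[t --> +oo] --> (0 : 'cV[R]_n).
Proof.
move=> A_ge0 d0 y_traj; apply/cvg_mxP => i j; rewrite [j]ord1 mxE.
set K := \sum_k `|y 0 k 0|.
have bound (t : R) : 0 <= t -> `|y t i 0| <= expR (- (d * t)) * K.
  move=> t0; rewrite expRN mulrC ler_pdivlMr ?expR_gt0 // mulrC.
  exact: trajectory_decay_norm_le.
have dty : d * t @[t --> +oo] --> +oo by apply: gt0_cvgMry => //; exact: cvg_id.
have K0 : expR (- (d * t)) * K @[t --> +oo] --> (0 : R).
  rewrite -[X in _ --> X](mul0r K); apply: cvgM; last exact: cvg_cst.
  exact: (cvg_comp _ (fun s : R => expR (- s)) dty (@cvgr_expR R)).
apply: norm_cvg0; apply: squeeze_cvgr K0; last exact: (cvg_cst (0 : R)).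
near=> t; rewrite normr_ge0 /=; apply: bound.
by near: t; apply: nbhs_pinfty_ge; exact: num_real.
Unshelve. all: by end_near. Qed.

Lemma trajectory0_cst (y : R -> 'cV[R]_1) t :
  trajectory 0 y -> 0 <= t -> y t = y 0.
Proof.
have le0 (z : R -> 'cV[R]_1) : trajectory 0 z -> 0 <= t -> z t 0 0 <= z 0 0 0.
  move=> z_traj t0; have := @trajectory_decay_le 1 0 0 (z 0 0 0) z.
  have -> : - (laplacian (0 : 'M[R]_1) + 0%:M) = 0.
    rewrite -[X in laplacian X](scale0r (0 : 'M[R]_1)) laplacianZ scale0r.
    by rewrite raddf0 addr0 oppr0.
  move=> /(_ _ z_traj _ 0 t t0); rewrite mul0r expR0 mul1r; apply=> [i j|i].
    by rewrite mxE.
  by rewrite [i]ord1.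
move=> y_traj t0; apply/colP => i; rewrite [i]ord1; apply: le_anti.
rewrite le0 //= -lerN2; have := le0 _ (trajectoryN y_traj) t0.
by rewrite !mxE.
Qed.

End Trajectories.

(** * The limit state *)

Section Consensus.
Variables (R : realType) (n : nat) (A : 'M[R]_n) (v : 'cV[R]_n) (d : R).
Hypotheses (A_ge0 : forall i j, 0 <= A i j) (v_sum1 : \sum_(i < n) v i 0 = 1).
Hypothesis d_gt0 : 0 < d.

Let L := laplacian A.
Let M := L + d *: (1%:M - ones *m v^T).

Lemma mulmx_weights_ones : v^T *m ones = 1%:M :> 'M[R]_1.
Proof.
apply/matrixP => i j; rewrite [i]ord1 [j]ord1 !mxE eqxx -[RHS]v_sum1.
by apply: eq_bigr => k _; rewrite !mxE mulr1.
Qed.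

(** With X the resolvent, X (L + d I) = d I and X 1 = 1; as M = L + d I - d
    1 v^T, this gives v^T X M = d v^T - d (v^T 1) v^T = 0. *)
Lemma resolvent_weights_conserved : v^T *m resolvent A d *m M = 0.
Proof.
have shift_inv : resolvent A d *m (L + d%:M) = d%:M.
  have -> : L + d%:M = d *: (1%:M + d^-1 *: L).
    rewrite scalerDr scalerA divff ?gt_eqF // scale1r addrC.
    by rewrite scale_scalar_mx mulr1.
  rewrite -scalemxAr /resolvent mulVmx; first by rewrite scale_scalar_mx mulr1.
  exact: resolvent_unit.
have -> : M = (L + d%:M) - d *: (ones *m v^T).
  by rewrite /M scalerBr scale_scalar_mx mulr1 addrA.
rewrite mulmxBr -!mulmxA shift_inv -scalemxAr [resolvent A d *m _]mulmxA.
rewrite resolvent_ones // -scalemxAr mulmxA mulmx_weights_ones mul1mx.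
by rewrite mul_mx_scalar subrr.
Qed.

(** The row p = v^T Jbar satisfies p L = 0 and p 1 = 1. These two relations
    make I - 1 p carry the flow of - M to that of - (L + d I),
    removing the rank-one feedback d 1 v^T. *)
Lemma intertwine_decay :
  (1%:M - ones *m (v^T *m Jbar A)) *m (- M) =
  - (L + d%:M) *m (1%:M - ones *m (v^T *m Jbar A)).
Proof.
rewrite mulmxN mulNmx; congr (- _).
have projM : v^T *m Jbar A *m M = d *: (v^T *m Jbar A - v^T).
  rewrite /M mulmxDr -mulmxA Jbar_laplacian // mulmx0 add0r -scalemxAr.
  rewrite mulmxBr mulmx1; congr (_ *: (_ - _)).
  by rewrite mulmxA -(mulmxA v^T) Jbar_ones // mulmx_weights_ones mul1mx.
rewrite mulmxBl mul1mx -mulmxA projM mulmxBr mulmx1 [in RHS]mulmxDl.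
rewrite [L *m _]mulmxA laplacian_ones mul0mx add0r mul_scalar_mx.
rewrite -scalemxAr mulmxBr /M !scalerBr scale_scalar_mx mulr1 opprB.
by rewrite !addrA subrK.
Qed.

Theorem consensus_limit (x : R -> 'cV[R]_n) : ode_solution (- M) x ->
  x t @[t --> +oo] --> ones *m v^T *m resolvent A d *m x 0.
Proof.
move=> /ode_solution_trajectory x_traj.
set p := v^T *m Jbar A; set w := v^T *m resolvent A d.
pose u t := (1%:M - ones *m p) *m x t.
have u_cvg0 : u t @[t --> +oo] --> (0 : 'cV[R]_n).
  by apply: (trajectory_cvg0 A_ge0 d_gt0); apply: trajectory_mulmx x_traj;
     exact: intertwine_decay.
have w_cst t : 0 <= t -> w *m x t = w *m x 0.
  move=> t0; apply: (trajectory0_cst (y := fun t => w *m x t)) => //.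
  apply: trajectory_mulmx x_traj.
  by rewrite mulmxN resolvent_weights_conserved oppr0 mul0mx.
(* From u = x - 1 p x and w 1 = 1 follows p x = w x - w u, hence x is recovered
   from u and from the conserved quantity w x. *)
have w_ones : w *m ones = 1%:M :> 'M[R]_1.
  by rewrite -mulmxA resolvent_ones // mulmx_weights_ones.
have x_lim : u t + ones *m (w *m x 0 - w *m u t) @[t --> +oo] -->
    (0 : 'cV[R]_n) + ones *m (w *m x 0 - w *m 0).
  apply: cvgD => //; apply: cvg_mulmx; first exact: cvg_cst.
  by apply: cvgB; [exact: cvg_cst | apply: cvg_mulmx => //; exact: cvg_cst].
have -> : ones *m v^T *m resolvent A d *m x 0 =
    (0 : 'cV[R]_n) + ones *m (w *m x 0 - w *m (0 : 'cV[R]_n)).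
  by rewrite mulmx0 subr0 add0r /w !mulmxA.
apply: cvg_trans x_lim; apply: near_eq_cvg; near=> t.
have t0 : 0 <= t by near: t; apply: nbhs_pinfty_ge; exact: num_real.
have uE : u t = x t - ones *m (p *m x t) by rewrite /u mulmxBl mul1mx mulmxA.
have wu : w *m u t = w *m x 0 - p *m x t.
  by rewrite uE mulmxBr (w_cst t t0) [w *m (ones *m _)]mulmxA w_ones mul1mx.
by rewrite wu subKr uE subrK.
Unshelve. all: by end_near. Qed.

End Consensus.

Theorem theorem4p2 (R : realType) (n : nat) (A : 'M[R]_n) (v : 'cV[R]_n)
    (A_ge0 : forall i j, 0 <= A i j)
    (v_ge0 : forall i, 0 <= v i 0)
    (v_sum1 : \sum_(i < n) v i 0 = 1) :
  let L : 'M[R]_n := laplacian A in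
  let V : 'M[R]_n := ones *m v^T in
  let D : 'M[R]_n := 1%:M - V in
  (forall (delta : R) (x : R -> 'cV[R]_n), 0 < delta ->
     ode_solution (- (L + delta *: D)) x ->
     (1%:M + delta^-1 *: L) \in unitmx /\
     x t @[t --> +oo] -->
       ones *m v^T *m invmx (1%:M + delta^-1 *: L) *m x 0)
  /\
  (forall (x0 : 'cV[R]_n) (x : R -> R -> 'cV[R]_n),
     (forall delta : R, 0 < delta ->
        ode_solution (- (L + delta *: D)) (x delta) /\ x delta 0 = x0) ->
     lim (x delta t @[t --> +oo]) @[delta --> 0^'+] -->
       ones *m v^T *m Jbar A *m x0).
Proof.
move=> L V D; split=> [delta x delta0 x_ode | x0 x x_ode].
  by split; [exact: resolvent_unit | exact: consensus_limit x_ode].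
have lim0 : (ones : 'cV[R]_n) *m v^T *m resolvent A delta *m x0
    @[delta --> 0^'+] --> ones *m v^T *m Jbar A *m x0.
  apply: cvg_mulmx; last exact: cvg_cst.
  by apply: cvg_mulmx; [exact: cvg_cst | exact: cvg_resolvent].
apply: cvg_trans lim0; apply: near_eq_cvg; near=> delta.
have delta0 : 0 < delta by [].
have [delta_ode <-] := x_ode delta delta0.
apply/esym/cvg_lim; first exact: norm_hausdorff.
exact: consensus_limit delta_ode.
Unshelve. all: by end_near. Qed.
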